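(* Let $M_3$ be the Turing machine with states $A,B$ (plus the halting state $H$), symbols $0,1,2,3,4$ ($0$ blank) and transition table $\delta(A,0)=(1,R,B)$, $\delta(A,1)=(2,L,A)$, $\delta(A,2)=(1,R,A)$, $\delta(A,3)=(2,L,B)$, $\delta(A,4)=(2,L,A)$; $\delta(B,0)=(0,L,A)$, $\delta(B,1)=(2,R,B)$, $\delta(B,2)=(3,R,B)$, $\delta(B,3)=(4,R,A)$, $\delta(B,4)=(1,R,H)$. For $n\ge 0$ define $C(n,1) = {}^\omega 0\,1\,3^n(B0)0^\omega$, $C(n,2) = {}^\omega 0\,2\,3^n(B0)0^\omega$, $C(n,3) = {}^\omega 0\,3^n(B0)0^\omega$, $C(n,4) = {}^\omega 0\,4\,1\,1\,3^n(B0)0^\omega$, $C(n,5) = {}^\omega 0\,4\,1\,2\,3^n(B0)0^\omega$, $C(n,6) = {}^\omega 0\,4\,1\,3^n(B0)0^\omega$, $C(n,7) = {}^\omega 0\,4\,2\,3^n(B0)0^\omega$, $C(n,8) = {}^\omega 0\,4\,3^n(B0)0^\omega$. Then (a) ${}^\omega 0(A0)0^\omega \vdash(1)\ C(0,1)$, and, for all integers $k\ge 0$: (b) $C(2k,1) \vdash(3k^2+8k+4)\ C(3k+1,1)$; (c) $C(2k,2) \vdash(3k^2+14k+9)\ C(3k+2,1)$; (d) $C(2k,3) \vdash(3k^2+8k+2)\ C(3k,1)$; (e) $C(2k,4) \vdash(3k^2+8k+8)\ C(3k+3,1)$; (f) $C(2k,5) \vdash(3k^2+14k+13)\ C(3k+4,1)$;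 (g) $C(2k,6) \vdash(3k^2+8k+6)\ C(3k+2,1)$; (h) $C(2k,7) \vdash(3k^2+14k+11)\ C(3k+3,1)$; (i) $C(2k,8) \vdash(3k^2+8k+4)\ C(3k+1,1)$; (j) $C(2k+1,1) \vdash(3k^2+8k+4)\ C(3k+1,2)$; (k) $C(2k+1,2) \vdash(3k^2+8k+4)\ C(3k+2,3)$; (l) $C(2k+1,3) \vdash(3k^2+8k+22)\ C(3k+1,4)$; (m) $C(2k+1,4) \vdash(3k^2+8k+4)\ C(3k+1,5)$; (n) $C(2k+1,5) \vdash(3k^2+8k+4)\ C(3k+2,6)$; (o) $C(2k+1,6) \vdash(3k^2+8k+4)\ C(3k+1,7)$; (p) $C(2k+1,7) \vdash(3k^2+8k+4)\ C(3k+2,8)$; (q) $C(2k+1,8) \vdash(3k^2+5k+3)\ {}^\omega 0\,1\,(H2)\,2^{3k}\,0^\omega$.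
   Context: Turing machines here have one tape, infinite in both directions. $\delta(q,a)=(b,D,q')$ means: in state $q$ reading symbol $a$, the machine writes $b$ on the current cell, moves the head one cell left ($D=L$) or right ($D=R$), and enters state $q'$. When the machine enters the halting state $H$ it stops. A configuration is written ${}^\omega 0\, x\,(S a)\, y\, 0^\omega$, where $x,y$ are finite words: the tape contains the word $xay$ surrounded on both sides by infinitely many $0$'s, the machine is in state $S$, and the head scans the cell containing the displayed symbol $a$. Each digit is one tape symbol; $w^n$ denotes the concatenation of $n$ copies of $w$ (an exponent applies to the single preceding symbol unless parentheses are used), $w^0$ is empty. $C_1 \vdash(t)\ C_2$ means that the machine, started in configuration $C_1$, is in configuration $C_2$ after exactly $t$ steps. *)

(* Defs.v *)
From mathcomp Require Import all_boot all_order all_algebra.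

Set Implicit Arguments.
Unset Strict Implicit.
Unset Printing Implicit Defensive.

Inductive sym := s0 | s1 | s2 | s3 | s4.
Inductive dir := L | R.
Inductive state := stA | stB | stH.

(* [None]: no move, the machine has stopped. *)
Definition table := state -> sym -> option (sym * dir * state).

Definition M3 : table := fun q a =>
  match q, a with
  | stA, s0 => Some (s1, R, stB)
  | stA, s1 => Some (s2, L, stA)
  | stA, s2 => Some (s1, R, stA)
  | stA, s3 => Some (s2, L, stB)
  | stA, s4 => Some (s2, L, stA)
  | stB, s0 => Some (s0, L, stA)
  | stB, s1 => Some (s2, R, stB)
  | stB, s2 => Some (s3, R, stB)
  | stB, s3 => Some (s4, R, stA)
  | stB, s4 => Some (s1, R, stH)
  | stH, _ => None
  end.

Record config := Config {
  cstate : state;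
  ctape : int -> sym;
  chead : int
}.

Definition write (tape : int -> sym) (p : int) (b : sym) : int -> sym :=
  fun i => if i == p then b else tape i.

Definition move (d : dir) (p : int) : int :=
  match d with L => (p - 1)%R | R => (p + 1)%R end.

Definition step (M : table) (c : config) : option config :=
  if M (cstate c) (ctape c (chead c)) is Some (b, d, q)
  then Some (Config q (write (ctape c) (chead c) b) (move d (chead c)))
  else None.

Fixpoint run (M : table) (t : nat) (c : config) : option config :=
  if t is t'.+1 then obind (run M t') (step M c) else Some c.

(* The written form of a configuration does not fix the origin of the tape, so
   configurations are compared up to a translation of the cells. *)
Definition same_config (c c' : config) : Prop :=
  cstate c = cstate c' /\
  exists d : int, chead c' = (chead c + d)%R /\
    forall i : int, ctape c' (i + d)%R = ctape c i.

Definition reaches (M : table) (t : nat) (c c' : config) : Prop :=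
  exists2 c1, run M t c = Some c1 & same_config c1 c'.

Notation "c '|-[' M , t ] c'" := (reaches M t c c')
  (at level 70, M at level 69, t at level 69, c' at level 69, no associativity,
   format "c  '|-[' M ,  t ]  c'").

(* The configuration written  ^omega 0 x (S a) y 0^omega, with the scanned cell
   at position 0. Since [Negz n] is the integer -(n+1), the word x is read
   backwards, its last letter being in cell -1. *)
Definition conf (x : seq sym) (S : state) (a : sym) (y : seq sym) : config :=
  Config S
    (fun i => match i with
              | Posz n => nth s0 (a :: y) n
              | Negz n => nth s0 (rev x) n
              end)
    0%R.

Definition C1 (n : nat) := conf ([:: s1] ++ nseq n s3) stB s0 [::].
Definition C2 (n : nat) := conf ([:: s2] ++ nseq n s3) stB s0 [::].
Definition C3 (n : nat) := conf (nseq n s3) stB s0 [::].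
Definition C4 (n : nat) := conf ([:: s4; s1; s1] ++ nseq n s3) stB s0 [::].
Definition C5 (n : nat) := conf ([:: s4; s1; s2] ++ nseq n s3) stB s0 [::].
Definition C6 (n : nat) := conf ([:: s4; s1] ++ nseq n s3) stB s0 [::].
Definition C7 (n : nat) := conf ([:: s4; s2] ++ nseq n s3) stB s0 [::].
Definition C8 (n : nat) := conf ([:: s4] ++ nseq n s3) stB s0 [::].

(* Main.v *)
Require Import Defs.
From mathcomp Require Import all_boot all_order all_algebra.
From mathcomp Require Import zify.

Set Implicit Arguments.
Unset Strict Implicit.
Unset Printing Implicit Defensive.

(** Write a configuration as a zipper [(q, l, r)], with the scanned cell first
    in [r].  One pass over a pair of 3's turns [3 (A3) 2^j] into
    [(A_) 2^(j+3)] in [2j+8] steps, so [k] passes send [w 3^(2k) (B0)] to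
    [w 2^(3k)], with the last letter of [w] scanned in state A, after
    [1 + 3k^2 + 5k] steps.  An odd 3, if any, is then consumed in one step that
    leaves the machine on [w] in state B.  A short case-by-case computation on
    [w] follows, ending in a sweep to the right over the 2's. *)

Definition zipper : Type := state * seq sym * seq sym.

(* Keeps words free of trailing blanks, so that a tape that becomes blank again
   to the right of the head is represented by [[::]]. *)
Definition cons_trim (a : sym) (r : seq sym) : seq sym :=
  match a, r with
  | s0, [::] => [::]
  | _, _ => a :: r
  end.

Definition zip_step (M : table) (z : zipper) : option zipper :=
  let: (q, l, r) := z in
  match M q (head s0 r) with
  | Some (b, R, q') => Some (q', b :: l, behead r)
  | Some (b, L, q') =>
      Some (q', behead l, cons_trim (head s0 l) (cons_trim b (behead r)))
  | None => None
  end.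

Fixpoint zip_run (M : table) (t : nat) (z : zipper) : option zipper :=
  if t is t'.+1 then obind (zip_run M t') (zip_step M z) else Some z.

Definition zip_tape (l r : seq sym) (i : int) : sym :=
  match i with Posz n => nth s0 r n | Negz n => nth s0 l n end.

(** Cells are indexed relative to the head, so configurations sharing a zipper differ only by a
    translation. *)
Definition represents (c : config) (z : zipper) : Prop :=
  let: (q, l, r) := z in
  cstate c = q /\ forall i : int, ctape c (i + chead c)%R = zip_tape l r i.

Lemma nth_cons_trim a r n : nth s0 (cons_trim a r) n = nth s0 (a :: r) n.
Proof. by case: a r n => [] [|b r] [|[|n]]. Qed.

Lemma represents_conf x q a y : represents (conf x q a y) (q, rev x, cons_trim a y).
Proof.
split=> // i; rewrite /= GRing.addr0.
by case: i => n //=; rewrite nth_cons_trim.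
Qed.

Lemma represents_same_config c c' z :
  represents c z -> represents c' z -> same_config c c'.
Proof.
case: z => [[q l] r] [qc tc] [qc' tc']; split; first by rewrite qc qc'.
exists (chead c' - chead c)%R; split; first by lia.
move=> i; have -> : i = (i - chead c + chead c)%R by lia.
rewrite tc -tc'; congr (ctape c' _); lia.
Qed.

Lemma represents_step M c z z' :
  represents c z -> zip_step M z = Some z' ->
  exists2 c', step M c = Some c' & represents c' z'.
Proof.
case: z => [[q l] r] [qc tc]; rewrite /= /step.
have -> : ctape c (chead c) = head s0 r.
  by have := tc 0%R; rewrite GRing.add0r /= nth0.
rewrite qc; case: (M q _) => [[[b []] q']|] // [<-]; eexists; try reflexivity.
- split=> //= i; rewrite /write.
  have -> : (i + (chead c - 1))%R = (i - 1 + chead c)%R by lia.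
  (* After a left move the cell just written has index 1 relative to the new head. *)
  rewrite tc; case: i => [[|[|n]]|n].
  + have -> : (0 - 1 + chead c == chead c)%R = false by lia.
    by rewrite /= nth_cons_trim /= nth0.
  + have -> : (1 - 1 + chead c == chead c)%R = true by lia.
    by rewrite /= nth_cons_trim /= nth_cons_trim.
  + have -> : (Posz n.+2 - 1 + chead c == chead c)%R = false by lia.
    have -> : (Posz n.+2 - 1)%R = Posz n.+1 by lia.
    by rewrite /= nth_cons_trim /= nth_cons_trim /= nth_behead.
  + have -> : (Negz n - 1 + chead c == chead c)%R = false by lia.
    have -> : (Negz n - 1)%R = Negz n.+1 by lia.
    by rewrite /= nth_behead.
- split=> //= i; rewrite /write.
  have -> : (i + (chead c + 1))%R = (i + 1 + chead c)%R by lia.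
  (* After a right move it has index -1, that is [Negz 0]. *)
  rewrite tc; case: i => [n|[|n]].
  + have -> : (Posz n + 1 + chead c == chead c)%R = false by lia.
    have -> : (Posz n + 1)%R = Posz n.+1 by lia.
    by rewrite /= nth_behead.
  + by have -> : (Negz 0 + 1 + chead c == chead c)%R = true by lia.
  + have -> : (Negz n.+1 + 1 + chead c == chead c)%R = false by lia.
    by have -> : (Negz n.+1 + 1)%R = Negz n by lia.
Qed.

Lemma represents_run M t c z z' :
  represents c z -> zip_run M t z = Some z' ->
  exists2 c', run M t c = Some c' & represents c' z'.
Proof.
elim: t c z => [|t IHt] c z cz /=; first by move=> [<-]; exists c.
case E: (zip_step M z) => [z1|] //= Hrun.
by have [c1 -> c1z1] := represents_step cz E; apply: IHt Hrun.
Qed.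

(** Turns each claim into an equation between finite lists, which short runs settle by reduction. *)
Lemma zip_run_reaches M t x q a y x' q' a' y' :
  zip_run M t (q, rev x, cons_trim a y) = Some (q', rev x', cons_trim a' y') ->
  conf x q a y |-[M, t] conf x' q' a' y'.
Proof.
move=> /(represents_run (represents_conf _ _ _ _)) [c cE cz]; exists c => //.
exact: represents_same_config cz (represents_conf _ _ _ _).
Qed.

Lemma zip_run_trans t1 t2 M t z1 z2 z3 :
  zip_run M t1 z1 = Some z2 -> zip_run M t2 z2 = Some z3 -> t = t1 + t2 ->
  zip_run M t z1 = Some z3.
Proof.
move=> + H2 ->; elim: t1 z1 => [|t1 IH] z1 /=; first by move=> [->].
by case: (zip_step M z1) => //= z; apply: IH.
Qed.

Lemma cat_nseq_cons n (a : sym) l : nseq n a ++ a :: l = a :: nseq n a ++ l.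
Proof. by elim: n => //= n ->. Qed.

Lemma sweep_right q a b :
  M3 q a = Some (b, R, q) ->
  forall n l r, zip_run M3 n (q, l, nseq n a ++ r) = Some (q, nseq n b ++ l, r).
Proof.
move=> qa; elim=> [|n IHn] l r //=.
by rewrite qa /= IHn cat_nseq_cons.
Qed.

Lemma sweep_ones_left n l r :
  zip_run M3 n.+1 (stA, nseq n s1 ++ l, s1 :: r)
  = Some (stA, behead l, cons_trim (head s0 l) (nseq n.+1 s2 ++ r)).
Proof.
elim: n r => [|n IHn] r //.
by have := IHn (s2 :: r); rewrite cat_nseq_cons.
Qed.

(** The situation between two passes; [head s0 l] is the last letter of the word, or a blank once
    the word is used up. *)
Definition scan_last (l : seq sym) (j : nat) : zipper :=
  (stA, behead l, cons_trim (head s0 l) (nseq j s2)).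

(** In [n] steps the 2's become 1's, two steps at the right end append another 1, and [n.+1] steps
    back turn all of them into 2's. *)
Lemma sweep_right_and_back n l :
  zip_run M3 (2 * n + 3) (stA, l, nseq n s2)
  = Some (scan_last l n.+1).
Proof.
apply: (@zip_run_trans n (n + 3) _ _ _ (stA, nseq n s1 ++ l, [::])); last by lia.
  by have := @sweep_right stA s2 s1 erefl n l [::]; rewrite cats0.
apply: (@zip_run_trans 2 n.+1 _ _ _ (stA, nseq n s1 ++ l, [:: s1])) => //; last by lia.
by rewrite sweep_ones_left cats0.
Qed.

(** Two steps turn 3 3 into 4 2, a round trip over [j.+1] 2's follows, and a last step turns the 4
    into a 2. *)
Lemma run_pass j l :
  zip_run M3 (2 * j + 8) (scan_last (s3 :: s3 :: l) j) = Some (scan_last l (j + 3)).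
Proof.
apply: (@zip_run_trans 2 (2 * j + 6) _ _ _ (stA, s4 :: l, nseq j.+1 s2)) => //;
  last by lia.
apply: (@zip_run_trans (2 * j.+1 + 3) 1); [exact: sweep_right_and_back | | by lia].
by rewrite addn3.
Qed.

(** Pass number i, counted from 0, meets j+3i 2's; the time is the sum of 2(j+3i)+8 over i < k. *)
Lemma run_passes k j l :
  zip_run M3 (3 * k ^ 2 + 5 * k + 2 * j * k) (scan_last (nseq (2 * k) s3 ++ l) j)
  = Some (scan_last l (j + 3 * k)).
Proof.
elim: k j => [|k IHk] j; first by rewrite exp0n // !muln0 !addn0.
have -> : 2 * k.+1 = (2 * k).+2 by lia.
have -> : j + 3 * k.+1 = j + 3 + 3 * k by lia.
by apply: zip_run_trans (run_pass j _) (IHk _) _; nia.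
Qed.

Lemma run_even k l :
  zip_run M3 (3 * k ^ 2 + 5 * k + 1) (stB, nseq (2 * k) s3 ++ l, [::])
  = Some (scan_last l (3 * k)).
Proof.
apply: (@zip_run_trans 1) (run_passes k 0 l) _; last by lia.
by [].
Qed.

Lemma run_odd k l :
  zip_run M3 (3 * k ^ 2 + 5 * k + 2) (stB, nseq (2 * k + 1) s3 ++ l, [::])
  = Some (stB, behead l, cons_trim (head s0 l) (nseq (3 * k + 1) s2)).
Proof.
rewrite nseqD -catA /=.
apply: (@zip_run_trans _ 1) (run_even k _) _ _; last by lia.
by rewrite addn1.
Qed.

Lemma sweep_twos_B n l :
  zip_run M3 n (stB, l, nseq n s2) = Some (stB, nseq n s3 ++ l, [::]).
Proof. by have := @sweep_right stB s2 s3 erefl n l [::]; rewrite cats0. Qed.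

Lemma scan_last_nil n :
  zip_run M3 n.+1 (scan_last [::] n) = Some (stB, nseq n s3 ++ [:: s1], [::]).
(* For [n = 0] the scanned blank is trimmed, hence the case split. *)
Proof. by rewrite -sweep_twos_B; case: n. Qed.

(** A scanned 2 acts as part of the block on its right and costs a full round trip; this is why 14k
    replaces 8k in some of the times. *)
Lemma scan_last_two n l :
  zip_run M3 (2 * n + 5) (scan_last (s2 :: l) n) = Some (scan_last l (n + 2)).
Proof. by rewrite addn2 -sweep_right_and_back; congr zip_run; lia. Qed.

Theorem theorem5p1 :
  conf [::] stA s0 [::] |-[M3, 1] C1 0 /\
  forall k : nat,
    C1 (2 * k) |-[M3, 3 * k ^ 2 + 8 * k + 4] C1 (3 * k + 1) /\
    C2 (2 * k) |-[M3, 3 * k ^ 2 + 14 * k + 9] C1 (3 * k + 2) /\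
    C3 (2 * k) |-[M3, 3 * k ^ 2 + 8 * k + 2] C1 (3 * k) /\
    C4 (2 * k) |-[M3, 3 * k ^ 2 + 8 * k + 8] C1 (3 * k + 3) /\
    C5 (2 * k) |-[M3, 3 * k ^ 2 + 14 * k + 13] C1 (3 * k + 4) /\
    C6 (2 * k) |-[M3, 3 * k ^ 2 + 8 * k + 6] C1 (3 * k + 2) /\
    C7 (2 * k) |-[M3, 3 * k ^ 2 + 14 * k + 11] C1 (3 * k + 3) /\
    C8 (2 * k) |-[M3, 3 * k ^ 2 + 8 * k + 4] C1 (3 * k + 1) /\
    C1 (2 * k + 1) |-[M3, 3 * k ^ 2 + 8 * k + 4] C2 (3 * k + 1) /\
    C2 (2 * k + 1) |-[M3, 3 * k ^ 2 + 8 * k + 4] C3 (3 * k + 2) /\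
    C3 (2 * k + 1) |-[M3, 3 * k ^ 2 + 8 * k + 22] C4 (3 * k + 1) /\
    C4 (2 * k + 1) |-[M3, 3 * k ^ 2 + 8 * k + 4] C5 (3 * k + 1) /\
    C5 (2 * k + 1) |-[M3, 3 * k ^ 2 + 8 * k + 4] C6 (3 * k + 2) /\
    C6 (2 * k + 1) |-[M3, 3 * k ^ 2 + 8 * k + 4] C7 (3 * k + 1) /\
    C7 (2 * k + 1) |-[M3, 3 * k ^ 2 + 8 * k + 4] C8 (3 * k + 2) /\
    C8 (2 * k + 1) |-[M3, 3 * k ^ 2 + 5 * k + 3]
      conf [:: s1] stH s2 (nseq (3 * k) s2).
Proof.
split; first exact: zip_run_reaches.
move=> k.
have even t w n q x :
  zip_run M3 t (scan_last (rev w) (3 * k)) = Some (q, rev x, [::]) ->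
  n = 3 * k ^ 2 + 5 * k + 1 + t ->
  conf (w ++ nseq (2 * k) s3) stB s0 [::] |-[M3, n] conf x q s0 [::].
  move=> Ht tE; apply: zip_run_reaches; rewrite rev_cat rev_nseq.
  exact: zip_run_trans (run_even _ _) Ht tE.
have odd t w n q a x y :
  zip_run M3 t (stB, behead (rev w), cons_trim (head s0 (rev w)) (nseq (3 * k + 1) s2))
    = Some (q, rev x, cons_trim a y) ->
  n = 3 * k ^ 2 + 5 * k + 2 + t ->
  conf (w ++ nseq (2 * k + 1) s3) stB s0 [::] |-[M3, n] conf x q a y.
  move=> Ht tE; apply: zip_run_reaches; rewrite rev_cat rev_nseq.
  exact: zip_run_trans (run_odd _ _) Ht tE.
(* Once [w] has been absorbed into [m] 2's in [s] steps, [m.+1] steps write the leading 1 and turn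
   the 2's into 3's. *)
have evenA s w t m n :
  zip_run M3 s (scan_last (rev w) (3 * k)) = Some (scan_last [::] m) ->
  n = 3 * k ^ 2 + 5 * k + 1 + (s + m.+1) -> t = m ->
  conf (w ++ nseq (2 * k) s3) stB s0 [::] |-[M3, n] C1 t.
  move=> Hs nE ->; apply: even nE; rewrite rev_cat rev_nseq.
  exact: zip_run_trans Hs (scan_last_nil m) erefl.
(* After [s] steps on [w] the head is back on the 2's in state B and sweeps them in 3k+1 steps; [m]
   counts the 3's already made from [w]. *)
have oddB s w w' t n m :
  zip_run M3 s (stB, behead (rev w), cons_trim (head s0 (rev w)) (nseq (3 * k + 1) s2))
    = Some (stB, nseq m s3 ++ rev w', nseq (3 * k + 1) s2) ->
  n = 3 * k ^ 2 + 8 * k + 3 + s -> t = 3 * k + 1 + m ->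
  conf (w ++ nseq (2 * k + 1) s3) stB s0 [::] |-[M3, n] conf (w' ++ nseq t s3) stB s0 [::].
  move=> Hs nE ->; apply: (odd (s + (3 * k + 1))); last by lia.
  rewrite rev_cat rev_nseq (nseqD (3 * k + 1) m) -catA.
  exact: zip_run_trans Hs (sweep_twos_B _ _) erefl.
do ![split].
(* State A turns a 1 or a 4 into a 2 in one step, moving left. *)
- by apply: (evenA 1 [:: s1] _ (3 * k).+1) => //; lia.
- by apply: (evenA _ [:: s2]); [exact: scan_last_two | lia |].
- by apply: (evenA 0 [::]) => //; lia.
- by apply: (evenA 3 [:: s4; s1; s1] _ (3 * k).+3) => //; lia.
- apply: (evenA (2 * (3 * k) + 5 + 2) [:: s4; s1; s2] _ (3 * k).+4); [|lia|lia].
  by apply: zip_run_trans (scan_last_two _ _) _ erefl; rewrite addn2.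
- by apply: (evenA 2 [:: s4; s1] _ (3 * k).+2) => //; lia.
- apply: (evenA (2 * (3 * k) + 5 + 1) [:: s4; s2] _ (3 * k).+3); [|lia|lia].
  by apply: zip_run_trans (scan_last_two _ _) _ erefl; rewrite addn2.
- by apply: (evenA 1 [:: s4] _ (3 * k).+1) => //; lia.
- by apply: (oddB 1 [:: s1] [:: s2] _ _ 0) => //; lia.
- by apply: (oddB 1 [:: s2] [::] _ _ 1) => //; lia.
(* With [w] empty, 19 steps on the blanks left of the 2's build 4 1 1; [addn1] shows the block of
   2's to be nonempty, so that [cons_trim] reduces. *)
- by apply: (oddB 19 [::] [:: s4; s1; s1] _ _ 0) => //; rewrite ?addn1 //; lia.
- by apply: (oddB 1 [:: s4; s1; s1] [:: s4; s1; s2] _ _ 0) => //; lia.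
- by apply: (oddB 1 [:: s4; s1; s2] [:: s4; s1] _ _ 1) => //; lia.
- by apply: (oddB 1 [:: s4; s1] [:: s4; s2] _ _ 0) => //; lia.
- by apply: (oddB 1 [:: s4; s2] [:: s4] _ _ 1) => //; lia.
(* State B halts on the 4, with no final sweep; [addn1] exposes the first 2 as the scanned
   symbol. *)
- by apply: (odd 1 [:: s4]); [rewrite addn1 | lia].
Qed.
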